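(* Let $\Gamma$ be a strictly Deza graph with parameters $(n,k,k-1,a)$ and $\beta(\Gamma)>1$. Then $a=2k-n$, and $\Gamma$ is recognizable by its parameters, i.e. every strictly Deza graph $\Gamma'$ with parameters $(n,k,k-1,a)$ and $\beta(\Gamma')>1$ is isomorphic to $\Gamma$.
   Context: All graphs are finite, undirected, without loops or multiple edges. For a vertex $v$, $N(v)$ is its set of neighbours. A nonempty $k$-regular graph $\Gamma$ on $n$ vertices is a Deza graph with parameters $(n,k,b,a)$, $b\ge a$, if every pair of distinct vertices has either exactly $b$ or exactly $a$ common neighbours. A strictly Deza graph is a Deza graph of diameter $2$ that is not strongly regular. For a vertex $v$, $B(v)$ is the set of vertices $u$ with $|N(v)\cap N(u)|=b$; for a strictly Deza graph $|B(v)|$ does not depend on $v$ and is denoted $\beta(\Gamma)$. *)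

(* Defs.v *)
From mathcomp Require Import all_boot all_order all_algebra.
From mathcomp Require Import zify.

Set Implicit Arguments.
Unset Strict Implicit.
Unset Printing Implicit Defensive.

Record sgraph := SGraph {
  vertex :> finType;
  adj : rel vertex;
  adj_sym : symmetric adj;
  adj_irr : irreflexive adj
}.

Definition isomorphic (G H : sgraph) : Prop :=
  exists f : G -> H,
    bijective f /\ (forall x y : G, adj (f x) (f y) = adj x y).

Definition neighbours (G : sgraph) (v : G) : {set G} := [set u | adj v u].

Definition regular (G : sgraph) (k : nat) : Prop :=
  forall v : G, #|neighbours v| = k.

Definition common (G : sgraph) (u v : G) : nat :=
  #|neighbours u :&: neighbours v|.

Definition is_walk (G : sgraph) (x y : G) (p : seq G) : Prop :=
  path (@adj G) x p /\ last x p = y.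

Definition is_dist (G : sgraph) (x y : G) (d : nat) : Prop :=
  (exists p, is_walk x y p /\ size p = d) /\
  (forall p, is_walk x y p -> d <= size p).

(* The first clause makes every distance finite, so only a connected graph
   has a diameter. *)
Definition has_diameter (G : sgraph) (d : nat) : Prop :=
  (forall x y : G, exists m, is_dist x y m /\ m <= d) /\
  (exists x y : G, is_dist x y d).

(* Complete and edgeless graphs are not excluded here; neither of them has
   diameter 2, so this convention does not affect [strictly_deza]. *)
Definition strongly_regular (G : sgraph) : Prop :=
  exists k l m : nat,
    regular G k /\
    (forall u v : G, adj u v -> common u v = l) /\
    (forall u v : G, u != v -> ~~ adj u v -> common u v = m).

Definition deza (G : sgraph) (n k b a : nat) : Prop :=
  [/\ #|G| = n, 0 < n, regular G k, a <= b
    & forall u v : G, u != v -> common u v = b \/ common u v = a].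

Definition strictly_deza (G : sgraph) (n k b a : nat) : Prop :=
  [/\ deza G n k b a, has_diameter G 2 & ~ strongly_regular G].

Definition Bset (G : sgraph) (b : nat) (v : G) : {set G} :=
  [set u | common v u == b].

(* The value of [#|Bset b v|] at an arbitrary vertex; by [card_Bset] the choice
   of the vertex is irrelevant when [G] is strictly Deza. *)
Definition beta (G : sgraph) (b : nat) : nat :=
  if [pick v : G] is Some v then #|Bset b v| else 0.

Lemma sum_common (G : sgraph) (k : nat) (v : G) :
  regular G k -> \sum_u common v u = k * k.
Proof.
move=> regG.
have commonE u : common v u = \sum_(w in neighbours v) (adj u w : nat).
  rewrite /common -sum1_card big_mkcond [RHS]big_mkcond; apply: eq_bigr => w _.
  by rewrite !inE; case: (adj v w); case: (adj u w).
under eq_bigr do rewrite commonE.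
rewrite exchange_big /= -[X in _ = X * _](regG v) -sum_nat_const.
apply: eq_bigr => w _.
rewrite -(regG w) -sum1_card [RHS]big_mkcond; apply: eq_bigr => u _.
by rewrite inE adj_sym; case: (adj w u).
Qed.

Lemma deza_ltn (G : sgraph) (n k b a : nat) :
  strictly_deza G n k b a -> a < b.
Proof.
move=> [[_ _ regG leab comG] _ nsrg]; rewrite ltn_neqAle leab andbT.
apply/eqP => eqab; apply: nsrg; exists k, b, b; split=> //.
have H (u v : G) : u != v -> common u v = b.
  by move=> /comG; rewrite eqab; case.
split=> u v; last by move=> /H.
by move=> uv; apply: H; apply: contraTneq uv => ->; rewrite adj_irr.
Qed.

Lemma card_Bset_eq (G : sgraph) (n k b a : nat) (v w : G) :
  strictly_deza G n k b a -> #|Bset b v| = #|Bset b w|.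
Proof.
move=> sG; have ltab := deza_ltn sG.
case: sG => [[cG _ regG _ comG] _ _].
have E (x : G) : k * k + (k == b) * b + (k != b) * a =
    k + (#|Bset b x| * b + #|~: Bset b x| * a).
  have cxx : common x x = k by rewrite /common setIid regG.
  have -> : #|Bset b x| * b + #|~: Bset b x| * a =
      \sum_u (if u \in Bset b x then b else a).
    rewrite -!sum_nat_const [RHS](bigID (mem (Bset b x))) /=; congr (_ + _).
      by apply: eq_bigr => u ->.
    by apply: eq_big => u; rewrite in_setC // => /negbTE ->.
  rewrite -(sum_common x regG) (bigD1 x) //= [in RHS](bigD1 x) //= inE cxx.
  have -> : \sum_(i | i != x) common x i =
      \sum_(i | i != x) (if i \in Bset b x then b else a).
    apply: eq_bigr => u; rewrite eq_sym => /comG; rewrite inE.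
    by case: eqP => [-> //|nb] [/nb|].
  by case: (k == b) => /=; lia.
have := E v; have := E w.
have := cardsC (Bset b v); have := cardsC (Bset b w).
rewrite cG; nia.
Qed.

Lemma card_Bset (G : sgraph) (n k b a : nat) (v : G) :
  strictly_deza G n k b a -> #|Bset b v| = beta G b.
Proof.
move=> sG; rewrite /beta; case: pickP => [w _|/(_ v)//].
exact: card_Bset_eq sG.
Qed.

(* Main.v *)
(* Let E relate [x] and [y] if [x = y] or they have [k - 1] common neighbours.
   The case [a = k - 2] is excluded by counting, so E is an equivalence, with
   classes of size [m = beta + 1 >= 3].  As A^3 is symmetric, A commutes with E,
   so every vertex of a class has the same number [r] of neighbours in another
   class, and [r] is symmetric.  Counting the pairs of twins separated by a
   vertex gives [sum r (m - r) = m - 1] over the classes, where each nonzero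
   term is at least [m - 1]: a class C has a unique "mate" p(C) with
   [0 < r < m], where [r = 1] or [r = m - 1], and is joined completely or not at
   all to any other.
   For classes C <> D the number of complete joins among {p(C), D} and
   {C, p(D)} is determined modulo [m] by [a], hence is a constant 0, 1 or 2.
   It is not 0 as the diameter is 2; it is not 1 by a parity argument on the
   quotient graph; if it is 2, then each class is its own mate and the graph is
   complete multipartite plus a perfect matching inside each part. *)

Require Import Defs.
From mathcomp Require Import all_boot all_order all_algebra.
From mathcomp Require Import zify.

Set Implicit Arguments.
Unset Strict Implicit.
Unset Printing Implicit Defensive.

(** * Counting common neighbours *)

Lemma common_sum (G : sgraph) (u v : G) :
  common u v = \sum_w adj u w * adj w v.
Proof.
rewrite /common -sum1_card big_mkcond; apply: eq_bigr => w _.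
by rewrite !inE [adj w v]adj_sym mulnb; case: (_ && _).
Qed.

Lemma commonC (G : sgraph) (u v : G) : common u v = common v u.
Proof. by rewrite /common setIC. Qed.

Lemma card_sum_nat (T : finType) (P : pred T) : #|[set x | P x]| = \sum_x P x.
Proof.
by rewrite -sum1_card big_mkcond; apply: eq_bigr => x _; rewrite inE; case: (P x).
Qed.

(** * Degree counts and the exclusion of [a = k - 2] *)

Section StrictlyDeza.
Variables (G : sgraph) (n k b a : nat).
Hypothesis sG : strictly_deza G n k b a.

(** The midpoint of a walk of length 2 would be a common neighbour. *)
Lemma adj_of_common0 (x y : G) : x != y -> common x y = 0 -> adj x y.
Proof.
case: sG => _ [dG _] _ nxy cxy; have [d [[[p [[pp lp] sp]] _]]] := dG x y.
rewrite -{}sp; case: p pp lp => [|z [|t [|//]]] /=.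
- by move=> _ exy; rewrite exy eqxx in nxy.
- by rewrite andbT => xz <-.
- move=> /and3P [xz zt _] ety _; subst t.
  suff : 0 < common x y by rewrite cxy.
  by apply/card_gt0P; exists z; rewrite !inE xz adj_sym.
Qed.

Lemma not_complete : exists x y : G, x != y /\ ~~ adj x y.
Proof.
case: sG => _ [_ [x [y [_ min_xy]]]] _; exists x, y; split.
  apply/eqP => exy; have := min_xy [::]; rewrite /is_walk /= exy.
  by move=> /(_ (conj isT erefl)).
apply/negP => xy; have := min_xy [:: y]; rewrite /is_walk /= xy.
by move=> /(_ (conj isT erefl)).
Qed.

Lemma adj_subset (x y : G) : ~~ adj x y -> neighbours x \subset ~: [set x; y].
Proof.
move=> nxy; apply/subsetP => z; rewrite !inE => xz; rewrite negb_or.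
by apply/andP; split; apply: contraTneq xz => ->; rewrite ?adj_irr.
Qed.

(** If [n <= k + 2], two nonadjacent vertices are both joined to all the others and share [k > b]
    neighbours. *)
Lemma degree_bound : b < k -> k + 3 <= n.
Proof.
move=> ltbk; have ltab := deza_ltn sG; have [x [y [nxy axy]]] := not_complete.
case: sG => [[cG _ rG _ comG] _ _].
have c2 : #|~: [set x; y]| + 2 = n by rewrite -cG -(cardsC [set x; y]) cards2 nxy addnC.
have sx := adj_subset axy.
have sy : neighbours y \subset ~: [set x; y].
  by rewrite setUC; apply: adj_subset; rewrite adj_sym.
have := subset_leq_card sx; rewrite rG => le_k.
have [//|lt_n] := leqP (k + 3) n.
have eN (z : G) : neighbours z \subset ~: [set x; y] -> neighbours z = ~: [set x; y].
  by move=> sz; apply/eqP; rewrite eqEcard sz rG; lia.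
have : common x y = k by rewrite /common (eN x) // (eN y) // setIid -(eN x) // rG.
by have [] := comG _ _ nxy; lia.
Qed.

Lemma card_Bset_nat (v : G) : #|Bset b v| = \sum_u (common v u == b).
Proof. exact: card_sum_nat. Qed.

(** Counts walks of length 2 from a vertex by their end; [b < k] keeps the vertex out of its own
    [Bset]. *)
Lemma degree_sq : b < k -> k * k = k + beta G b * (b - a) + n.-1 * a.
Proof.
move=> ltbk; have ltab := deza_ltn sG; have [x _] := not_complete.
rewrite -(card_Bset x sG) card_Bset_nat.
case: sG => [[cG _ rG _ comG] _ _].
have cxx : common x x = k by rewrite /common setIid rG.
rewrite -(sum_common x rG) (bigD1 x) //= [\sum_u (_ == _)](bigD1 x) //= cxx.
have -> : n.-1 = \sum_(i | i != x) 1 by rewrite sum1_card -cG cardC1.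
rewrite gtn_eqF // add0n !big_distrl -addnA -big_split; congr (_ + _).
apply: eq_bigr => u; rewrite eq_sym => /comG [] -> /=; rewrite ?eqxx ?ltn_eqF //; lia.
Qed.

End StrictlyDeza.

(** If [a = k - 2], the degree count leaves only [k = 2] and [a = 0], and the graph is strongly
    regular like the pentagon. *)
Lemma strictly_deza_gap (G : sgraph) (n k a : nat) :
  strictly_deza G n k k.-1 a -> 1 < beta G k.-1 -> a + 3 <= k.
Proof.
move=> sG gt1; have ltab := deza_ltn sG; have ltbk : k.-1 < k by lia.
have [//|lt_k] := leqP (a + 3) k; have ek : k = a + 2 by lia.
have := degree_sq sG ltbk; have le_n := degree_bound sG ltbk.
rewrite (_ : k.-1 - a = 1); last by lia.
move: gt1; set be := beta _ _ => gt1 ekk.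
have [a0 be2] : a = 0 /\ be = 2 by nia.
subst a; subst k; case: {+}sG => [[cG _ rG _ comG] _ []].
exists 2, 0, 1; split=> //.
have nadj (u v : G) : u != v -> ~~ adj u v -> common u v = 1.
  move=> nuv; have [//|c0] := comG _ _ nuv.
  by rewrite (adj_of_common0 sG).
split=> // u v uv; have nuv : u != v by apply: contraTneq uv => ->; rewrite adj_irr.
have [/= c1|//] := comG _ _ nuv.
(* [Bset 1 u] contains [v] and the [n - 3 >= 2] non-neighbours of [u], against [beta = 2]. *)
have sB : ~: (u |: neighbours u) \subset Bset 1 u :\ v.
  apply/subsetP => w; rewrite !inE negb_or eq_sym => /andP [nuw auw].
  by rewrite nadj // eqxx andbT; apply: contraNneq auw => ->.
have := subset_leq_card sB; have := cardsC (u |: neighbours u).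
rewrite cardsU1 inE adj_irr (rG u) cG.
have := cardsD1 v (Bset 1 u); rewrite inE c1 eqxx (card_Bset u sG) -/be be2 /=.
lia.
Qed.

(** * Residues and parity *)

Lemma modn_eq_of_sum (m u v s t : nat) :
  s < m -> t < m -> m * u + s = m * v + t -> s = t.
Proof.
move=> ls lt e; rewrite -(modn_small ls) -(modn_small lt).
by rewrite -(modnMDl u s) -(modnMDl v t) mulnC e mulnC.
Qed.

(** Handshake lemma: every edge is counted once from each end, the ends being ordered by
    [enum_rank]. *)
Lemma sum_sym_rel_even (T : finType) (F : rel T) :
  symmetric F -> irreflexive F -> ~~ odd (\sum_x \sum_y F x y).
Proof.
move=> symF irrF.
pose lo x y : nat := F x y && (enum_rank x < enum_rank y).
have split_xy x y : F x y = lo x y + lo y x :> nat.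
  rewrite /lo [F y x]symF; case Fxy: (F x y) => //=.
  have: val (enum_rank x) != val (enum_rank y).
    apply: contraTneq Fxy => e; suff -> : x = y by rewrite irrF.
    exact/enum_rank_inj/val_inj.
  by case: ltngtP.
have -> : \sum_x \sum_y F x y = (\sum_x \sum_y lo x y) + \sum_x \sum_y lo x y.
  rewrite [X in _ = _ + X]exchange_big -big_split; apply: eq_bigr => x _.
  by rewrite -big_split; apply: eq_bigr => y _.
by rewrite addnn odd_double.
Qed.

(* With [P] the permutation matrix of [p], the last hypothesis says that [P F]
   is a tournament, so that [|T| = 2 f + 1]; then [f = 2 c + 1], and [|T|] and
   [f] are both odd, against the handshake lemma. *)
Lemma no_twisted_tournament (T : finType) (F : rel T) (p : T -> T) (f c : nat) :
  symmetric F -> irreflexive F -> involutive p ->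
  (forall x, ~~ F x (p x)) ->
  (forall x, \sum_y F x y = f) ->
  (forall x y, x != y -> \sum_z (F x z && F y z) = c) ->
  (forall x y, x != y -> F y (p x) + F x (p y) = 1) ->
  #|T| <= 1.
Proof.
move=> symF irrF invp Fp degF comF tourF.
have [//|nT] := leqP #|T| 1.
have /card_gt0P [x _] : 0 < #|T| by lia.
have cT : #|T|.-1 = \sum_(y | y != x) 1 by rewrite sum1_card cardC1.
have e1 : #|T|.-1 = f + f.
  have -> : #|T|.-1 = \sum_(y | y != x) (F x (p y) + F y (p x)).
    by rewrite cT; apply: eq_bigr => y /tourF.
  rewrite big_split /=; congr (_ + _).
    rewrite -(degF x) [RHS](reindex_inj (inv_inj invp)) [RHS](bigD1 x) //=.
    by rewrite (negbTE (Fp x)).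
  rewrite -(degF (p x)) [RHS](bigD1 x) //= symF (negbTE (Fp x)).
  by apply: eq_bigr => y _; rewrite symF.
(* Walks of length 2 from [x], counted by midpoint and by end. *)
have e2 : f * f = f + c * #|T|.-1.
  have -> : f * f = \sum_z \sum_y (F x z && F z y).
    rewrite -{1}(degF x) big_distrl; apply: eq_bigr => z _ /=.
    by rewrite -(degF z) big_distrr /=; apply: eq_bigr => y _; rewrite mulnb.
  rewrite exchange_big (bigD1 x) //= -{1}(degF x); congr (_ + _).
    by apply: eq_bigr => z _; rewrite [F z x]symF andbb.
  rewrite cT big_distrr /=; apply: eq_bigr => y; rewrite eq_sym muln1 => /comF <-.
  by apply: eq_bigr => z _; rewrite [F z y]symF.
have := sum_sym_rel_even symF irrF.
under eq_bigr do rewrite degF.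
rewrite sum_nat_const oddM.
have -> : #|T| = (f + f).+1 by lia.
have -> : f = (c + c).+1 by nia.
by rewrite /= !oddD /= !oddD !addbb.
Qed.

(** * Quotient by an equivalence with classes of equal size *)

Section Quotient.
Variables (T : finType) (E : rel T) (m : nat).
Hypothesis eqE : equivalence_rel E.
Hypothesis cardE : forall x, #|[set y | E x y]| = m.

Let Exx x : E x x. Proof. by case: (eqE x x x). Qed.
Let EtransL x y : E x y -> E x =1 E y.
Proof. by move=> xy z; case: (eqE x y z) => _; apply. Qed.
Let Esym x y : E x y = E y x.
Proof. by apply/idP/idP => h; rewrite -(EtransL h) Exx. Qed.

(** [pick] sees only the extension of [E x], so related elements get the same representative. *)
Definition rep (x : T) : T := odflt x [pick y | E x y].

Lemma rep_rel x : E x (rep x).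
Proof. by rewrite /rep; case: pickP. Qed.

Lemma rep_eq x y : (rep x == rep y) = E x y.
Proof.
apply/eqP/idP => [e|xy]; first by rewrite (EtransL (rep_rel x)) e Esym rep_rel.
rewrite /rep (eq_pick (EtransL xy)); case: pickP => // /(_ y).
by rewrite Exx.
Qed.

Lemma rep_idem x : rep (rep x) == rep x.
Proof. by rewrite rep_eq Esym rep_rel. Qed.

Definition quot := {x : T | rep x == x}.

Definition proj (x : T) : quot := exist _ (rep x) (rep_idem x).

Lemma val_proj_rel x : E x (val (proj x)).
Proof. exact: rep_rel. Qed.

Lemma proj_eq x y : (proj x == proj y) = E x y.
Proof. by rewrite -(inj_eq val_inj) /= rep_eq. Qed.

Lemma projK (c : quot) : proj (val c) = c.
Proof. by apply: val_inj; apply/eqP; apply: (valP c). Qed.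

Lemma quot_eq (c d : quot) : (c == d) = E (val c) (val d).
Proof. by rewrite -proj_eq !projK. Qed.

Lemma card_invariant (S : pred T) :
  (forall x y, E x y -> S x = S y) ->
  \sum_x S x = m * \sum_(c : quot) S (val c).
Proof.
move=> invS; rewrite (partition_big proj predT) //= big_distrr.
apply: eq_bigr => c _ /=.
rewrite -(cardE (val c)) card_sum_nat big_distrl big_mkcond /=; apply: eq_bigr => x _.
rewrite -{1}(projK c) proj_eq Esym mulnb; case: ifP => //= /invS -> //.
Qed.

End Quotient.

(** * Numbering the classes that meet a subset *)

(** Listing only the classes that meet [A] keeps the numbers small, so that nested relations yield
    coordinates. *)
Definition quot_coord (T : finType) (E : rel T) (A : {set T}) (x : T) : nat :=
  index [set y | E x y] (enum [set [set z | E y z] | y in A]).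

Section Coordinates.
Variables (T : finType) (E : rel T) (A : {set T}).
Hypothesis eqE : equivalence_rel E.

Let classE (x y : T) : ([set z | E x z] == [set z | E y z]) = E x y.
Proof.
apply/eqP/idP => [/setP/(_ y)|xy].
  by rewrite !inE; case: (eqE y y y) => -> _ ->.
by apply/setP => z; rewrite !inE; case: (eqE x y z) => _ /(_ xy).
Qed.

Lemma quot_coord_inj :
  {in A &, forall x y, (quot_coord E A x == quot_coord E A y) = E x y}.
Proof.
move=> x y xA yA; rewrite -classE; apply/eqP/eqP => [|e]; last by rewrite /quot_coord e.
by move=> /index_inj; apply; rewrite ?(mem_enum, imset_f).
Qed.

Lemma card_classes (m : nat) :
  (forall x, x \in A -> #|A :&: [set y | E x y]| = m) ->
  #|A| = m * #|[set [set z | E y z] | y in A]|.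
Proof.
move=> cardE; rewrite -sum1_card (partition_big_imset (fun y => [set z | E y z])) /=.
rewrite mulnC -sum_nat_const; apply: eq_bigr => C /imsetP [x xA ->].
rewrite -(cardE x xA) -sum1_card; apply: eq_bigl => y.
by rewrite !inE classE; case: (y \in A) => //=; rewrite -!classE eq_sym.
Qed.

Lemma quot_coord_lt (m t : nat) (x : T) :
  (forall y, y \in A -> #|A :&: [set z | E y z]| = m) ->
  0 < m -> #|A| = m * t -> x \in A -> quot_coord E A x < t.
Proof.
move=> cardE m0 cA xA; have /eqP := card_classes cardE.
rewrite cA eqn_pmul2l // => /eqP ->.
by rewrite /quot_coord [X in _ < X]fintype.cardE index_mem mem_enum imset_f.
Qed.

End Coordinates.

(** * A coordinate model of the extremal graph *)

Lemma isomorphic_of_model (G H : sgraph) (M : Type) (R : rel M)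
    (f : G -> M) (g : H -> M) :
  bijective f -> bijective g ->
  (forall x y, adj x y = R (f x) (f y)) ->
  (forall x y, adj x y = R (g x) (g y)) -> isomorphic H G.
Proof.
move=> [f' fK f'K] [g' gK g'K] adjG adjH; exists (f' \o g); split.
  by exists (g' \o f) => x /=; rewrite ?f'K ?g'K ?fK ?gK.
by move=> x y; rewrite adjG adjH /= !f'K.
Qed.

(* A complete multipartite graph with parts (the classes of [E]) of size [m],
   to which a perfect matching (the classes of [P]) is added in every part. *)
Record matched_multipartite (G : sgraph) (m : nat) (E P : rel G) : Prop := {
  part_equiv : equivalence_rel E;
  pair_equiv : equivalence_rel P;
  pair_part : subrel P E;
  card_part : forall x, #|[set y | E x y]| = m;
  card_pair : forall x, #|[set y | P x y]| = 2;
  adj_matched : forall x y, adj x y = ~~ E x y || P x y && (x != y)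
}.

(** The coordinates are the part, the pair within the part and the place within the pair. *)
Definition matched_multipartite_adj (t h : nat) : rel ('I_t * 'I_h * 'I_2) :=
  fun u v => (u.1.1 != v.1.1) || (u.1.2 == v.1.2) && (u.2 != v.2).

(** The coordinates number the classes of [E] in [G], of [P] in a class of [E], and of equality in a
    class of [P]; each is compared only once the earlier ones agree. *)
Lemma matched_multipartite_model (G : sgraph) (m : nat) (E P : rel G) :
  0 < m -> matched_multipartite m E P ->
  exists f : G -> 'I_(#|G| %/ m) * 'I_(m %/ 2) * 'I_2,
    bijective f /\ forall x y, adj x y = matched_multipartite_adj (f x) (f y).
Proof.
move=> m0 [eqE eqvP subPE cardE cardP adjG].
have setE x y : E x y -> [set z | E x z] = [set z | E y z].
  by move=> xy; apply/setP => z; rewrite !inE; case: (eqE x y z) => _ /(_ xy).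
have setPair x y : P x y -> [set z | P x z] = [set z | P y z].
  by move=> xy; apply/setP => z; rewrite !inE; case: (eqvP x y z) => _ /(_ xy).
have memE x : x \in [set z | E x z] by rewrite inE; case: (eqE x x x).
have memP x : x \in [set z | P x z] by rewrite inE; case: (eqvP x x x).
have eq_equiv : equivalence_rel (@eq_op G).
  by move=> x y z; rewrite eqxx; split=> // /eqP ->.
have cE y : y \in [set: G] -> #|[set: G] :&: [set z | E y z]| = m.
  by rewrite setTI cardE.
have cP x y : y \in [set z | E x z] -> #|[set z | E x z] :&: [set z | P y z]| = 2.
  rewrite inE => xy; rewrite (setIidPr _) ?cardP // (setE _ _ xy).
  by apply/subsetP => z; rewrite !inE; apply: subPE.
have c1 x y : y \in [set z | P x z] -> #|[set z | P x z] :&: [set z | y == z]| = 1.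
  move=> xy; rewrite -[RHS](cards1 y); apply: eq_card => z.
  by rewrite !inE; case: eqVneq xy => [<-|]; rewrite ?inE ?andbT ?andbF.
have cG : #|[set: G]| = m * (#|G| %/ m).
  have := card_classes eqE cE; rewrite cardsT => e.
  by rewrite {2}e mulKn // -e.
have cM (x : G) : #|[set z | E x z]| = 2 * (m %/ 2).
  have := card_classes eqvP (cP x); rewrite cardE => e.
  by rewrite {2}e mulKn // -e.
have lt1 x := quot_coord_lt eqE cE m0 cG (in_setT x).
have lt2 x := quot_coord_lt eqvP (cP x) isT (cM x) (memE x).
have lt3 x := quot_coord_lt eq_equiv (c1 x) isT (etrans (cardP x) (esym (mul1n 2)))
  (memP x).
pose f x := (Ordinal (lt1 x), Ordinal (lt2 x), Ordinal (lt3 x)).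
have f1 x y : ((f x).1.1 == (f y).1.1) = E x y.
  by rewrite -(inj_eq val_inj) /= quot_coord_inj ?in_setT.
have f2 x y : E x y -> ((f x).1.2 == (f y).1.2) = P x y.
  move=> xy; rewrite -(inj_eq val_inj) /= (setE _ _ xy) quot_coord_inj //.
  by rewrite -(setE _ _ xy).
have f3 x y : P x y -> ((f x).2 == (f y).2) = (x == y).
  move=> xy; rewrite -(inj_eq val_inj) /= (setPair _ _ xy) quot_coord_inj //.
  by rewrite -(setPair _ _ xy).
exists f; split.
  (* Injectivity suffices: rounding down in the quotients keeps the target no larger than [G]. *)
  apply: inj_card_bij => [x y fxy|].
    have xy : E x y by rewrite -f1 fxy.
    have pxy : P x y by rewrite -f2 // fxy.
    by apply/eqP; rewrite -f3 // fxy.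
  rewrite !card_prod !card_ord -mulnA.
  by apply: leq_trans (leq_divM _ m); rewrite leq_mul2l leq_divM orbT.
move=> x y; rewrite adjG /matched_multipartite_adj f1.
case xy: (E x y) => //=; rewrite f2 //.
by case pxy: (P x y) => //=; rewrite f3.
Qed.

(** * Twin classes *)

Section Classes.
Variables (G : sgraph) (n k a : nat).
Hypothesis sG : strictly_deza G n k k.-1 a.
Hypothesis gt1 : 1 < beta G k.-1.

Let gap : a + 3 <= k. Proof. exact: strictly_deza_gap sG gt1. Qed.
Let regG : regular G k. Proof. by case: sG => [[]]. Qed.
Let degE (x : G) : \sum_y adj x y = k. Proof. by rewrite -card_sum_nat regG. Qed.

(** Equality is added because [common x x] is [k], not [k.-1]. *)
Definition twin : rel G := fun x y => (x == y) || (common x y == k.-1).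
Notation E := twin.
Notation m := (beta G k.-1).+1.

(** Entrywise form of [A^2 = a J + (k - 1 - a) E + I], with [A] the adjacency matrix and [J] the
    all-ones matrix. *)
Lemma common_twin (x y : G) : common x y = a + (k.-1 - a) * E x y + (x == y).
Proof.
rewrite /E; have [<-|nxy] := eqVneq x y; first by rewrite /common setIid regG /=; lia.
case: sG => [[_ _ _ _ comG] _ _]; case: (comG _ _ nxy) => -> /=.
  by rewrite eqxx; lia.
by rewrite ltn_eqF; lia.
Qed.

Lemma twin_refl : reflexive E.
Proof. by move=> x; rewrite /E eqxx. Qed.

Lemma twin_sym : symmetric E.
Proof. by move=> x y; rewrite /E eq_sym commonC. Qed.

(** [N(x)] and [N(z)] each miss at most one vertex of [N(y)], so they share at least [k - 2 > a]
    vertices. *)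
Lemma twin_trans : transitive E.
Proof.
move=> y x z xy yz; have [<-|nxz] := eqVneq x z; first exact: twin_refl.
have := common_twin x y; have := common_twin y z; rewrite xy yz => cyz cxy.
have sN : (neighbours x :&: neighbours y) :|: (neighbours y :&: neighbours z)
    \subset neighbours y by rewrite subUset subsetIr subsetIl.
have sI : (neighbours x :&: neighbours y) :&: (neighbours y :&: neighbours z)
    \subset neighbours x :&: neighbours z.
  by rewrite setISS // ?subsetIl ?subsetIr.
have := cardsUI (neighbours x :&: neighbours y) (neighbours y :&: neighbours z).
have := subset_leq_card sN; have := subset_leq_card sI.
rewrite regG -!/(common _ _) cxy cyz; have := common_twin x z.
case: (E x z) => // ->; rewrite (negbTE nxz) /=; lia.
Qed.

Lemma twin_equiv : equivalence_rel E.
Proof.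
apply/equivalence_relP; split; first exact: twin_refl.
exact: sym_left_transitive twin_sym twin_trans.
Qed.

Let twinL (x y : G) : E x y -> E x =1 E y.
Proof. by move=> xy z; case: (twin_equiv x y z) => _; apply. Qed.

Lemma card_twin (x : G) : #|[set y | E x y]| = m.
Proof.
have -> : [set y | E x y] = x |: Bset k.-1 x.
  by apply/setP => y; rewrite !inE /E [y == x]eq_sym.
by rewrite cardsU1 (card_Bset x sG) inE /common setIid regG; case: eqP => //; lia.
Qed.

Let sum_twin (x : G) : \sum_y E x y = m.
Proof. by rewrite -card_sum_nat card_twin. Qed.

(** These are the entries of the matrix product [A E]. *)
Definition deg_in (x y : G) : nat := \sum_z (adj x z && E y z).
Notation r := deg_in.

(* Both sides are read off from the number of walks of length 3 from [x] to
   [y], split either at the last or at the first step. *)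
Lemma deg_inC (x y : G) : r x y = r y x.
Proof.
have walks3 (u v : G) : \sum_z adj u z * common z v =
    k * a + (k.-1 - a) * r u v + adj u v.
  rewrite -{1}(degE u) big_distrl big_distrr /=.
  rewrite -(big_pred1_eq addn v (fun z => adj u z : nat)).
  rewrite [\sum_(z | z == v) _]big_mkcond -!big_split; apply: eq_bigr => z _ /=.
  rewrite common_twin [E v z]twin_sym; case: (adj u z); case: (E z v);
    case: (z == v) => /=; rewrite ?muln0 ?muln1 ?mul1n ?mul0n; lia.
have : \sum_z adj x z * common z y = \sum_z adj y z * common z x.
  have sumE (u v : G) : \sum_z adj u z * common z v =
      \sum_z \sum_w adj u z * (adj z w * adj w v).
    by apply: eq_bigr => z _; rewrite common_sum big_distrr.
  rewrite !sumE exchange_big; apply: eq_bigr => z _; apply: eq_bigr => w _.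
  rewrite [adj z y]adj_sym [adj w z]adj_sym [adj x w]adj_sym.
  by rewrite mulnA mulnC mulnA mulnAC mulnA.
rewrite !walks3 [adj y x]adj_sym => /addIn/addnI/eqP.
by rewrite eqn_pmul2l ?subn_gt0 => [/eqP|]; lia.
Qed.

Lemma deg_in_twinr (x y z : G) : E y z -> r x y = r x z.
Proof. by move=> yz; apply: eq_bigr => w _; rewrite (twinL yz). Qed.

(** Symmetry of [r] carries the evident invariance from the second argument to the first. *)
Lemma deg_in_twinl (x y z : G) : E x y -> r x z = r y z.
Proof. by rewrite ![r _ z]deg_inC; apply: deg_in_twinr. Qed.

Lemma deg_inN (x y : G) : r x y + \sum_z (~~ adj x z && E y z) = m.
Proof.
rewrite -(sum_twin y) -big_split; apply: eq_bigr => z _ /=.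
by case: (adj x z); case: (E y z).
Qed.

Lemma deg_in_le (x y : G) : r x y <= m.
Proof. by rewrite -(deg_inN x y) leq_addr. Qed.

(* Double counting of the triples [(y, u, v)] with [u], [v] in the class of [x]
   and [y] adjacent to [u] but not to [v]. *)
Lemma sum_deg_in (x : G) : \sum_y r x y * (m - r x y) = m * m.-1.
Proof.
have diff (u v : G) : \sum_y (adj y u && ~~ adj y v) + common u v = k.
  rewrite -(degE u) common_sum -big_split; apply: eq_bigr => y _ /=.
  by rewrite [adj y u]adj_sym; case: (adj u y); case: (adj y v).
transitivity (\sum_y \sum_u \sum_v (E x u && E x v) * (adj y u && ~~ adj y v)).
  apply: eq_bigr => y _; rewrite deg_inC -{1}(deg_inN y x) addKn big_distrl.
  apply: eq_bigr => u _; rewrite big_distrr; apply: eq_bigr => v _ /=.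
  by case: (E x u); case: (E x v); case: (adj y u); case: (adj y v).
rewrite exchange_big.
transitivity (\sum_u E x u * m.-1); last by rewrite -big_distrl sum_twin.
apply: eq_bigr => u _; rewrite exchange_big /=.
(* Distinct twins share [k - 1] neighbours, so exactly one [y] is adjacent to [u] and not to [v]. *)
transitivity (\sum_(v | v != u) E x u * E x v).
  rewrite [RHS]big_mkcond; apply: eq_bigr => v _.
  rewrite -big_distrr /=; have := diff u v; rewrite common_twin.
  case xu: (E x u); case xv: (E x v); rewrite ?mul0n ?if_same //=.
  by rewrite -(twinL xu) xv eq_sym; case: (v == u) => /=; lia.
rewrite -big_distrr; case xu: (E x u) => //; congr (_ * _).
by have := sum_twin x; rewrite (bigD1 u) //= xu => -[].
Qed.

(** * The mate of a class *)

Let mul_compl_ge s : 0 < s < m -> m.-1 <= s * (m - s).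
Proof. by move=> hs; nia. Qed.

Definition mate (x : G) : G := odflt x [pick y | 0 < r x y < m].
Notation p := mate.

(** The sum in [sum_deg_in] is positive, so some term is nonzero and [pick] succeeds. *)
Lemma mate_range (x : G) : 0 < r x (p x) < m.
Proof.
rewrite /p; case: pickP => //= none.
have := sum_deg_in x; rewrite big1 => [|y _]; first by nia.
by have := none y; have := deg_in_le x y; case: (r x y) => // s; nia.
Qed.

Let sum_class (y : G) (c : nat) : \sum_(z | E y z) c = m * c.
Proof.
by rewrite sum_nat_cond_const -(card_twin y); congr (_ * _).
Qed.

Let sum_mate_class (x y : G) :
  \sum_(z | E y z) r x z * (m - r x z) = m * (r x y * (m - r x y)).
Proof. by rewrite -(sum_class y); apply: eq_bigr => z /deg_in_twinr <-. Qed.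

(** The class of [p x] alone contributes at least [m (m - 1)], which is the whole sum in
    [sum_deg_in]. *)
Lemma mate_unique (x y : G) : 0 < r x y < m -> E (p x) y.
Proof.
move=> ry; apply/negPn/negP => npy.
have := sum_deg_in x; rewrite (bigID (E (p x))) /= sum_mate_class (bigD1 y) //=.
have := mul_compl_ge ry; have := mul_compl_ge (mate_range x).
set s := \sum_(_ | _) _; nia.
Qed.

(** With [t = r x (p x)], the class of [p x] contributes [m t (m - t) <= m (m - 1)], which leaves
    only the extreme values of [t]. *)
Lemma mate_val (x : G) : r x (p x) = 1 \/ r x (p x) = m.-1.
Proof.
have := sum_deg_in x; rewrite (bigID (E (p x))) /= sum_mate_class.
set s := \sum_(_ | _) _; have := mate_range x; set t := r x _ => ht e.
have : t * (m - t) <= m.-1 by nia.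
have [?|?] : t = 1 \/ 1 < t by lia.
  by left.
by right; nia.
Qed.

(** * Complete joins between classes *)

(** As [r] depends only on classes, this says that the two classes are completely joined. *)
Definition full : rel G := fun x y => r x y == m.
Notation F := full.

Lemma full_sym : symmetric F.
Proof. by move=> x y; rewrite /F deg_inC. Qed.

Lemma full_twinr (x y z : G) : E y z -> F x y = F x z.
Proof. by move=> /deg_in_twinr e; rewrite /F e. Qed.

Lemma full_twinl (x y z : G) : E x y -> F x z = F y z.
Proof. by move=> /deg_in_twinl e; rewrite /F e. Qed.

Lemma full_adj (x y : G) : F x y -> adj x y.
Proof.
move=> /eqP fxy; have := deg_inN x y; rewrite fxy.
have add_eq s : m + s = m -> s = 0 by lia.
by move=> /add_eq; rewrite (bigD1 y) //= twin_refl andbT; case: (adj x y).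
Qed.

Lemma adj_full (x y : G) : adj x y -> ~~ E (p x) y -> F x y.
Proof.
move=> xy; apply: contraR => nF; apply: mate_unique; move: nF (deg_in_le x y).
rewrite /F; have : 0 < r x y by rewrite /r (bigD1 y) //= xy twin_refl.
by rewrite [_ < m]ltn_neqAle => -> -> ->.
Qed.

Lemma full_irr : irreflexive F.
Proof. by move=> x; apply/negbTE/negP => /full_adj; rewrite adj_irr. Qed.

Lemma full_mate (x y : G) : E (p x) y -> F x y = false.
Proof.
by move=> py; rewrite -(full_twinr x py) /F ltn_eqF //; case/andP: (mate_range x).
Qed.

Lemma mateK (x : G) : E (p (p x)) x.
Proof. by apply: mate_unique; rewrite deg_inC mate_range. Qed.

Lemma mate_twin (x y : G) : E x y -> E (p x) (p y).
Proof.
by move=> xy; apply: mate_unique; rewrite (deg_in_twinl _ xy) mate_range.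
Qed.

Lemma mate_twinE (x y : G) : E (p x) (p y) = E x y.
Proof.
apply/idP/idP => [/mate_twin pp|]; last exact: mate_twin.
by rewrite -(twinL (mateK x)) (twinL pp) mateK.
Qed.

(** * Counting over the quotient graph *)

Notation Q := (quot E).
Notation eps := (k %% m).

Lemma adj_mate_full (x y : G) : adj x y = (adj x y && E (p x) y) + F x y :> nat.
Proof.
case py: (E (p x) y); first by rewrite full_mate // andbT addn0.
rewrite andbF; congr nat_of_bool; apply/idP/idP; last exact: full_adj.
by move=> xy; apply: adj_full; rewrite ?py.
Qed.

Lemma degree_quot (x : G) : k = r x (p x) + m * \sum_(c : Q) F x (val c).
Proof.
rewrite -(card_invariant twin_equiv card_twin (full_twinr x)) -{1}(degE x).
by rewrite -big_split; apply: eq_bigr => y _; rewrite adj_mate_full.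
Qed.

(** Complete joins contribute a multiple of [m] to [k], so [r x (p x)], lying strictly between 0 and
    [m], is the residue of [k]. *)
Lemma mate_eps (x : G) : r x (p x) = eps.
Proof.
have /= -> := congr1 (modn^~ m) (degree_quot x).
rewrite addnC mulnC modnMDl modn_small //.
by case/andP: (mate_range x).
Qed.

Lemma eps_val : eps = 1 \/ eps = m.-1.
Proof. by have [x _] := not_complete sG; rewrite -(mate_eps x); apply: mate_val. Qed.

(** The class of [p x] holds [eps] common neighbours if it is completely joined to [y] and none
    otherwise; likewise for [p y]. Any other class counts wholly or not at all. *)
Lemma common_quot (x y : G) : ~~ E x y ->
  a = eps * (F y (p x) + F x (p y)) + m * \sum_(c : Q) (F x (val c) && F y (val c)).
Proof.
move=> nxy; have := common_twin x y; rewrite (negbTE nxy) muln0 addn0.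
have -> : (x == y) = false by apply: contraNF nxy => /eqP ->; apply: twin_refl.
rewrite addn0 => <-.
rewrite -(@card_invariant _ _ _ twin_equiv card_twin (fun z => F x z && F y z)); last first.
  by move=> u v uv; rewrite (full_twinr x uv) (full_twinr y uv).
rewrite mulnDr -{1}(mate_eps x) -(mate_eps y) /r !big_distrl -!big_split.
rewrite common_sum; apply: eq_bigr => z _ /=; rewrite [adj z y]adj_sym.
have [px|npx] := boolP (E (p x) z).
  have npy : ~~ E (p y) z by rewrite twin_sym -(twinL px) mate_twinE.
  rewrite (full_mate px) (full_twinr y px) /= (negbTE npy) andbT andbF mul0n !addn0.
  by have := adj_mate_full y z; rewrite (negbTE npy) andbF => ->.
have := adj_mate_full x z; rewrite (negbTE npx) !andbF => ->.
have [py|npy] := boolP (E (p y) z).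
  by rewrite (full_mate py) (full_twinr x py) andbT andbF mul0n addn0 mulnC.
have := adj_mate_full y z; rewrite (negbTE npy) !andbF => ->.
by rewrite !mul0n !add0n; case: (F x z); case: (F y z).
Qed.

(** Otherwise any two vertices share [k - 1] neighbours and the graph is strongly regular. *)
Lemma not_all_twins : exists x y : G, ~~ E x y.
Proof.
have [x [y _]] := not_complete sG.
have [z nxz|all_x] := pickP (fun z => ~~ E x z); first by exists x, z.
have all2 (u v : G) : u != v -> common u v = k.-1.
  move=> nuv; have : E u v by rewrite -(twinL (negbFE (all_x u))) (negbFE (all_x v)).
  by rewrite /E (negbTE nuv) => /eqP.
case: sG => _ _ []; exists k, k.-1, k.-1; split=> //; split=> u v uv.
  by apply: all2; apply: contraTneq uv => ->; rewrite adj_irr.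
by move=> _; apply: all2.
Qed.

(** * Crossing joins between two classes and their mates *)

(** Modulo [m], [a] is plus or minus the number of crossings, and 0, 1, 2 are distinct modulo
    [m >= 3]. *)
Lemma crossing_const : exists s c, forall x y : G, ~~ E x y ->
  F y (p x) + F x (p y) = s /\ \sum_(z : Q) (F x (val z) && F y (val z)) = c.
Proof.
have [x0 [y0 n0]] := not_all_twins; have a0 := common_quot n0.
exists (F y0 (p x0) + F x0 (p y0)), (\sum_(z : Q) (F x0 (val z) && F y0 (val z))).
move=> x y nxy; have := common_quot nxy; rewrite {1}a0.
set c := \sum_z _; set c0 := \sum_z _.
have : F y (p x) + F x (p y) <= 2 by case: (F y _); case: (F x _).
have : F y0 (p x0) + F x0 (p y0) <= 2 by case: (F y0 _); case: (F x0 _).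
set s := F y _ + _; set s0 := F y0 _ + _ => ls0 ls e.
have es : s = s0.
  have [e1|em] := eps_val.
    apply: (@modn_eq_of_sum m c0 c); move: gt1 e; rewrite ?e1; lia.
  apply: (@modn_eq_of_sum m (c + s0) (c0 + s)); move: gt1 e; rewrite ?em; nia.
split=> //; move: e; rewrite es => /addnI/eqP; rewrite eqn_pmul2l // => /eqP -> //.
Qed.

(** Without crossings [F] is empty, so all neighbours lie in the mate class and non-twins share
    none; diameter 2 then makes non-twins adjacent, which is a complete join. *)
Lemma crossing_neq0 :
  (forall x y : G, ~~ E x y -> F y (p x) + F x (p y) = 0) -> False.
Proof.
move=> s0.
have noF (x y : G) : F y (p x) = false.
  have [xy|/s0] := boolP (E x y); last by case: (F y (p x)).
  by rewrite -(full_twinl _ xy) full_mate ?twin_refl.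
have noF2 (x y : G) : F x y = false by rewrite -(full_twinr x (mateK y)) noF.
have adjE (x y : G) : adj x y -> E (p x) y.
  by move=> xy; apply: contraFT (noF2 x y); apply: adj_full.
have nadj (x y : G) : ~~ E x y -> adj x y.
  move=> nxy; apply: (adj_of_common0 sG).
    by apply: contraNneq nxy => ->; apply: twin_refl.
  apply/eqP; rewrite cards_eq0; apply/set0Pn => -[z]; rewrite !inE.
  move=> /andP [/adjE px /adjE py]; case/negP: nxy.
  by rewrite -mate_twinE (twinL px) twin_sym.
have [x [y nxy]] := not_all_twins.
have pxy := adjE _ _ (nadj _ _ nxy).
have := noF2 x y; rewrite /F => /eqP; apply.
rewrite -(sum_twin y); apply: eq_bigr => z _; congr nat_of_bool.
rewrite andbC; case yz: (E y z) => //=; apply/nadj.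
by rewrite twin_sym -(twinL yz) twin_sym.
Qed.

(** The classes with [F] and [mate] would form the structure excluded by [no_twisted_tournament],
    with degree [k %/ m]. *)
Lemma crossing_neq1 :
  (forall x y : G, ~~ E x y -> F y (p x) + F x (p y) = 1) -> False.
Proof.
move=> s1; have [s [c comF]] := crossing_const.
pose pQ (u : Q) : Q := proj twin_equiv (p (val u)).
have pQ_rel (u : Q) : E (p (val u)) (val (pQ u)) by apply: val_proj_rel.
have := @no_twisted_tournament Q (fun u v => F (val u) (val v)) pQ (k %/ m) c.
have eqQ (u v : Q) : (u == v) = E (val u) (val v) by apply: (quot_eq twin_equiv).
have [x [y nxy]] := not_all_twins.
suff : 1 < #|{: Q}|.
  rewrite ltnNge => /negP nT H; apply: nT; apply: H.
  - by move=> u v; apply: full_sym.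
  - by move=> u; apply: full_irr.
  - move=> u; apply/eqP; rewrite eqQ -(twinL (pQ_rel (pQ u))).
    by rewrite -(twinL (mate_twin (pQ_rel u))) mateK.
  - by move=> u; rewrite full_mate.
  - move=> u; have := degree_quot (val u); rewrite mate_eps.
    rewrite {1}(divn_eq k m) addnC mulnC => /addnI/eqP.
    by rewrite eqn_pmul2l // => /eqP <-.
  - by move=> u v; rewrite eqQ => /comF [].
  - move=> u v; rewrite eqQ => /s1.
    by rewrite (full_twinr _ (pQ_rel u)) (full_twinr _ (pQ_rel v)).
apply/card_gt1P; exists (proj twin_equiv x), (proj twin_equiv y); split=> //.
by rewrite proj_eq.
Qed.

Lemma crossing2 (x y : G) : ~~ E x y -> F y (p x) && F x (p y).
Proof.
have [s [c H]] := crossing_const.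
have [u [v nuv]] := not_all_twins; have [hs _] := H _ _ nuv.
have [e|ne] := eqVneq s 2.
  by move=> /H [+ _]; rewrite e; case: (F y _); case: (F x _).
case: (boolP (s == 0)) => [/eqP e|ne0].
  by case: crossing_neq0 => {}x {}y /H [+ _]; rewrite e.
have e : s = 1 by move: hs ne ne0; case: (F v _); case: (F u _) => <-.
by case: crossing_neq1 => {}x {}y /H [+ _]; rewrite e.
Qed.

(** * Structure of the graph when both crossings are present *)

(** Otherwise the crossings for [x] and [p x] would include a complete join of the class of [p x] to
    itself. *)
Lemma mate_class (x : G) : E (p x) x.
Proof.
apply/negPn/negP; rewrite twin_sym => npx.
by have := crossing2 npx; rewrite full_irr.
Qed.
Lemma nontwin_full (x y : G) : ~~ E x y -> F x y.
Proof.
by move=> /crossing2/andP [_]; rewrite (full_twinr _ (mate_class y)).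
Qed.

Lemma nontwin_adj (x y : G) : ~~ E x y -> adj x y.
Proof. by move=> /nontwin_full/full_adj. Qed.

(** A vertex is joined to everything outside its class, so [r x x = m - 1] would give
    [k = n - 1]. *)
Lemma deg_in_self (x : G) : r x x = 1 /\ n + 1 = m + k.
Proof.
have cG : #|G| = n by case: sG => [[]].
have e : n + r x x = m + k.
  rewrite -cG -(sum_twin x) -(degE x) -sum1_card -!big_split.
  apply: eq_bigr => y _ /=; have [xy|nxy] := boolP (E x y); first by rewrite andbT.
  by rewrite nontwin_adj // andbF.
suff r1 : r x x = 1 by split=> //; rewrite -e r1.
move: e; rewrite -(deg_in_twinr x (mate_class x)); have [//|->] := mate_val x.
by have := degree_bound sG; lia.
Qed.

(** As [r x x = 1], adjacency inside a class is a perfect matching; adding equality makes it an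
    equivalence. *)
Definition matched : rel G := fun x y => (x == y) || adj x y && E x y.

Lemma matched_unique (x y z : G) :
  adj x y && E x y -> adj x z && E x z -> y = z.
Proof.
move=> hy hz; apply/eqP/negPn/negP; rewrite eq_sym => nyz.
have [+ _] := deg_in_self x; rewrite /r (bigD1 y) //= (bigD1 z) //= hy hz.
by lia.
Qed.

Lemma matched_equiv : equivalence_rel matched.
Proof.
have symM : symmetric matched.
  by move=> x y; rewrite /matched eq_sym adj_sym twin_sym.
apply/equivalence_relP; split; first by move=> x; rewrite /matched eqxx.
apply: (sym_left_transitive symM) => y x z; rewrite [matched x y]symM /matched.
case/orP=> [/eqP -> //|yx] /orP [/eqP <-|yz]; last by rewrite (matched_unique yx yz) eqxx.
by move: yx; rewrite adj_sym twin_sym orbC => ->.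
Qed.

Lemma strictly_deza_matched_multipartite : matched_multipartite m E matched.
Proof.
split; [exact: twin_equiv | exact: matched_equiv | | exact: card_twin | | ].
- by move=> x y /orP [/eqP ->|/andP [_ //]]; apply: twin_refl.
- move=> x; have [e _] := deg_in_self x; rewrite -[2]/(1.+1) -{1}e /r.
  rewrite card_sum_nat (bigD1 x) //= [in RHS](bigD1 x) //= adj_irr add0n.
  rewrite {1}/matched eqxx /= -add1n; congr (_ + _); apply: eq_bigr => y.
  by rewrite eq_sym /matched => /negbTE ->.
- move=> x y; have [xy|nxy] := boolP (E x y); last by rewrite nontwin_adj.
  rewrite /matched xy andbT /=; case: eqVneq => [->|_]; first by rewrite adj_irr.
  by rewrite /= andbT.
Qed.

(** The neighbourhoods of two non-twins cover the graph and meet in [a] vertices. *)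
Lemma deza_parameter : a + n = 2 * k.
Proof.
have [x [y nxy]] := not_all_twins.
have cU : neighbours x :|: neighbours y = [set: G].
  apply/setP => z; rewrite !inE; have [xz|/nontwin_adj -> //] := boolP (E x z).
  by rewrite [adj y z]nontwin_adj ?orbT // twin_sym -(twinL xz).
have := cardsUI (neighbours x) (neighbours y).
rewrite cU cardsT !regG -/(common x y) common_twin (negbTE nxy) muln0.
have -> : (x == y) = false by apply: contraNF nxy => /eqP ->; apply: twin_refl.
by case: sG => [[-> _ _ _ _] _ _]; lia.
Qed.

End Classes.

Theorem theorem2 (G : sgraph) (n k a : nat) :
  strictly_deza G n k k.-1 a ->
  1 < beta G k.-1 ->
  (a%:Z = 2%:Z * k%:Z - n%:Z)%R /\
  (forall H : sgraph,
     strictly_deza H n k k.-1 a -> 1 < beta H k.-1 -> isomorphic H G).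
Proof.
move=> sG gtG; split; first by have := deza_parameter sG gtG; lia.
move=> H sH gtH.
have [x _] := not_complete sG; have [y _] := not_complete sH.
have [_ eG] := deg_in_self sG gtG x; have [_ eH] := deg_in_self sH gtH y.
(* The part size is [n + 1 - k], so the parameters determine the model. *)
have em : beta G k.-1 = beta H k.-1 by lia.
have eGH : #|H| = #|G| by case: sG => [[-> _ _ _ _] _ _]; case: sH => [[]].
have [f [bijf adjf]] :=
  matched_multipartite_model (ltn0Sn _) (strictly_deza_matched_multipartite sG gtG).
have [g [bijg adjg]] :=
  matched_multipartite_model (ltn0Sn _) (strictly_deza_matched_multipartite sH gtH).
rewrite eGH -em in g bijg adjg.
exact: isomorphic_of_model bijf bijg adjf adjg.
Qed.
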